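(* Let $F \in \mathcal{S}_d$ be a (nonzero) form of local GAD-rank at most $d$. Then $F$ has at most $d^n$ minimal supports (counted up to nonzero scalar multiples).
   Context: Let $n \ge 1$ be an integer, $\Bbbk$ a field whose characteristic is zero or strictly larger than $d$, $\mathcal{S} = \bigoplus_d \mathcal{S}_d = \Bbbk[x_0,\dots,x_n]$ and $\mathcal{R} = \Bbbk[y_0,\dots,y_n]$ with standard gradings. Forms differing by a nonzero scalar are identified, and uniqueness/finiteness is understood up to this identification. Local GAD: for a nonzero form $F \in \mathcal{S}_d$ and a nonzero linear form $\ell \in \mathcal{S}_1$ there is a unique way of writing $F = \omega\,\ell^{d-k}$ with $0 \le k \le d$, $\omega \in \mathcal{S}_k$ and $\ell \nmid \omega$; this is the local generalized additive decomposition (local GAD) of $F$ supported at $\ell$ (the case $k=d$, i.e. $F = F\ell^0$, is allowed). Dual generator: given $\ell$, complete it to a basis $(\ell, z_1,\dots,z_n)$ of $\mathcal{S}_1$ (for $\ell = x_0 + \xi_1x_1+\dots+\xi_nx_n$ one takes $z_i = x_i$). Write $F$ as a polynomial in $\ell, z_1,\dots,z_n$, $F = \sum F_{\alpha_0,\alpha}\,\ell^{\alpha_0} z^{\alpha}$, form its divided power representation $F_{\rm dp} = \sum \alpha_0!\,\alpha!\,F_{\alpha_0,\alpha}\,\ell^{\alpha_0}z^\alpha$, and set $\ell = 1$: this gives $f_\ell = \sum \alpha_0!\,\alpha!\,F_{\alpha_0,\alpha}\,z^\alpha \in \Bbbk[z_1,\dots,z_n]_{\le d}$. Natural apolar scheme: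 let $(Y_0,\dots,Y_n)$ be the basis of $\mathcal{R}_1$ dual to $(\ell,z_1,\dots,z_n)$ (with $y_i$ dual to $x_i$). Let $\Bbbk[Y_1,\dots,Y_n]$ act on $\Bbbk[z_1,\dots,z_n]$ by contraction: $Y^\beta \lrcorner z^\alpha = z^{\alpha-\beta}$ if $\alpha \ge \beta$ componentwise and $0$ otherwise. Let $\mathrm{Ann}^{\lrcorner}(f_\ell) = \{g \in \Bbbk[Y_1,\dots,Y_n] : g \lrcorner f_\ell = 0\}$. The homogenization of this ideal with respect to $Y_0$ is the ideal of a zero-dimensional scheme $\mathcal{Z} \subset \mathbb{P}^n(\Bbbk)$ supported at the point of coefficients of $\ell$; it is called the natural apolar scheme of $F$ at $\ell$, or the scheme evinced by the local GAD (it does not depend on the choice of $z_1,\dots,z_n$). The size of the local GAD is the length of $\mathcal{Z}$, equivalently $\dim_\Bbbk \Bbbk[Y_1,\dots,Y_n]/\mathrm{Ann}^{\lrcorner}(f_\ell)$. The local GAD-rank of $F$ is the minimal size of a local GAD of $F$. A minimal support of $F$ is a linear form $\ell \in \mathcal{S}_1$ (up to scalar) such that the local GAD of $F$ supported at $\ell$ has size equal to the local GAD-rank of $F$. *)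

(* Defs.v *)
From HB Require Import structures.
From mathcomp Require Export all_boot all_algebra.
From mathcomp.multinomials Require Export mpoly.

Set Implicit Arguments.
Unset Strict Implicit.
Unset Printing Implicit Defensive.

Import GRing.Theory.
Local Open Scope ring_scope.

Definition linear_form (K : fieldType) (m : nat) (l : {mpoly K[m]}) : Prop :=
  l \is 1.-homog /\ l != 0.

Definition proportional (K : fieldType) (m : nat) (l l' : {mpoly K[m]}) : Prop :=
  exists2 c : K, c != 0 & l' = c *: l.

Definition linear_basis (K : fieldType) (m : nat)
    (B : m.-tuple {mpoly K[m]}) : Prop :=
  (forall i, tnth B i \is 1.-homog) /\
  (forall l : {mpoly K[m]}, l \is 1.-homog ->
     exists! c : {ffun 'I_m -> K}, l = \sum_(i < m) c i *: tnth B i).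

(* F = omega * l ^ (d - k), with k <= d, omega a form of degree k prime to l. *)
Definition local_gad (K : fieldType) (n d : nat) (F l : {mpoly K[n.+1]})
    (k : nat) (omega : {mpoly K[n.+1]}) : Prop :=
  [/\ linear_form l, (k <= d)%N, omega \is k.-homog,
      ~ (exists q, omega = q * l) & F = omega * l ^+ (d - k)].

Definition divided_power (K : fieldType) (m : nat) (P : {mpoly K[m]})
    : {mpoly K[m]} :=
  \sum_(a <- msupp P) ((\prod_(i < m) (a i)`!)%:R * P@_a) *: 'X_[a].

(* Substitutes 1 for the variable of index 0 and shifts the other ones down. *)
Definition dehomogenize (K : fieldType) (n : nat) (P : {mpoly K[n.+1]})
    : {mpoly K[n]} :=
  P \mPo [tuple of 1 :: [tuple 'X_j | j < n]].

(* f is the dual generator of F at l computed in the basis (l, z_1, ..., z_n):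
   P is the expression of F as a polynomial in l, z_1, ..., z_n. *)
Definition dual_generator (K : fieldType) (n : nat) (F l : {mpoly K[n.+1]})
    (z : n.-tuple {mpoly K[n.+1]}) (f : {mpoly K[n]}) : Prop :=
  linear_basis [tuple of l :: z] /\
  exists2 P : {mpoly K[n.+1]},
    F = P \mPo [tuple of l :: z] & f = dehomogenize (divided_power P).

(* Both k[Y_1, ..., Y_n] (first argument) and k[z_1, ..., z_n] are {mpoly K[n]}. *)
Definition contraction (K : fieldType) (n : nat) (g f : {mpoly K[n]})
    : {mpoly K[n]} :=
  \sum_(b <- msupp g) \sum_(a <- msupp f | (b <= a)%MM)
     (g@_b * f@_a) *: 'X_[(a - b)%MM].

Definition Ann (K : fieldType) (n : nat) (f : {mpoly K[n]})
    : pred {mpoly K[n]} :=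
  fun g => contraction g f == 0.

(* For an ideal I: the classes of b_0, ..., b_(r-1) are a basis of k[Y] / I. *)
Definition quotient_dim (K : fieldType) (n : nat) (I : pred {mpoly K[n]})
    (r : nat) : Prop :=
  exists b : 'I_r -> {mpoly K[n]}, forall p : {mpoly K[n]},
    exists! c : {ffun 'I_r -> K}, I (p - \sum_(i < r) c i *: b i).

(* The size of the local GAD of F at l is the length of the scheme Z it evinces.
   The ideal of Z is the homogenization of Ann f, so Z lies in the chart
   Y_0 != 0, has coordinate ring k[Y_1, ..., Y_n] / Ann f there, and its length
   is the dimension of that ring. It does not depend on the completion z of l
   to a basis of the linear forms, so any completion may be used. *)
Definition local_gad_size (K : fieldType) (n d : nat) (F l : {mpoly K[n.+1]})
    (r : nat) : Prop :=
  (exists k omega, local_gad d F l k omega) /\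
  exists z f, dual_generator F l z f /\ quotient_dim (Ann f) r.

Definition local_gad_rank (K : fieldType) (n d : nat) (F : {mpoly K[n.+1]})
    (r : nat) : Prop :=
  (exists l, local_gad_size d F l r) /\
  (forall l r', local_gad_size d F l r' -> (r <= r')%N).

Definition minimal_support (K : fieldType) (n d : nat) (F l : {mpoly K[n.+1]})
    : Prop :=
  exists2 r, local_gad_rank d F r & local_gad_size d F l r.

(* Main.v *)
(** If [l] does not divide [F], the dual generator [f] of [F] at [l] has a
    monomial of degree [d] (the characteristic being zero or larger than [d]),
    and contracting [f] by a divisor of that monomial in each degree
    [0, ..., d] gives [d + 1] linearly independent polynomials, so the size at
    [l] exceeds [d]. Hence every minimal support of a form of rank at most [d]
    divides [F]. Pairwise non-proportional linear forms are non-associated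
    primes, so there are at most [d] of them, and [d <= d ^ n]. *)
Require Import Defs.
From mathcomp Require Import all_boot all_algebra.
From mathcomp.multinomials Require Import mpoly.
From mathcomp Require Import zify.

Import GRing.Theory.
Local Open Scope ring_scope.

Set Implicit Arguments.
Unset Strict Implicit.
Unset Printing Implicit Defensive.

(** * Linear changes of coordinates *)

Lemma comp_mpolyA (K : fieldType) (m n k : nat) (p : {mpoly K[m]})
    (B : m.-tuple {mpoly K[n]}) (C : n.-tuple {mpoly K[k]}) :
  (p \mPo B) \mPo C = p \mPo [tuple tnth B i \mPo C | i < m].
Proof.
rewrite !(comp_mpolyE p) raddf_sum /=; apply: eq_bigr => a _.
rewrite comp_mpolyZ rmorph_prod /=; congr (_ *: _); apply: eq_bigr => i _.
by rewrite rmorphXn tnth_mktuple.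
Qed.

Lemma comp_mpoly_homog (K : fieldType) (m n d : nat) (p : {mpoly K[m]})
    (B : m.-tuple {mpoly K[n]}) :
  p \is d.-homog -> (forall i, tnth B i \is 1.-homog) -> p \mPo B \is d.-homog.
Proof.
move=> hp hB; rewrite comp_mpolyE big_seq rpred_sum // => a ap.
apply: rpredZ; have <- : mdeg a = d := dhomog_mf hp ap; rewrite mdegE.
elim/big_rec2: _ => [|i e q _ hq]; first exact: dhomog1.
by apply: dhomogM hq; have := dhomogMn (a i) (hB i); rewrite mul1n.
Qed.

Lemma homog1E (K : fieldType) (m : nat) (p : {mpoly K[m]}) :
  p \is 1.-homog -> p = \sum_(j < m) p@_U_(j) *: 'X_j.
Proof.
move=> hp; apply/mpolyP => a; rewrite raddf_sum /=.
under eq_bigr => j _ do rewrite mcoeffZ mcoeffX.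
have [/eqP/mdeg1P [i /eqP ->]|Na] := eqVneq (mdeg a) 1%N.
  rewrite (bigD1 i) //= eqxx mulr1 big1 ?addr0 // => j ji.
  by rewrite eq_mnm1 (negbTE ji) mulr0.
rewrite (dhomog_nemf_coeff hp Na) big1 // => j _.
by case: (U_(j)%MM =P a) Na => [<-|_ _]; rewrite ?mdeg1 ?mulr0.
Qed.

(** The entries of [C] express each variable in the basis [B], so substituting [B] into [C] gives
    back the variables by construction; the other composite uses uniqueness of coordinates. This
    lets a linear form be treated as the variable of index 0. *)
Lemma linear_basis_inverse (K : fieldType) (m : nat)
    (B : m.-tuple {mpoly K[m]}) :
  linear_basis B ->
  exists C : m.-tuple {mpoly K[m]},
    [/\ forall i, tnth C i \is 1.-homog,
        cancel (comp_mpoly B) (comp_mpoly C) &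
        cancel (comp_mpoly C) (comp_mpoly B)].
Proof.
case=> hB uB.
have X1 (i : 'I_m) : ('X_i : {mpoly K[m]}) \is 1.-homog.
  by rewrite dhomogX /= mdeg1.
have [c hc] := fin_all_exists (fun i => uB _ (X1 i)).
pose C := [tuple \sum_(j < m) c i j *: ('X_j : {mpoly K[m]}) | i < m].
have hC i : tnth C i \is 1.-homog.
  by rewrite tnth_mktuple rpred_sum // => j _; rewrite rpredZ.
have lincomp (e : 'I_m -> K) :
    (\sum_(j < m) e j *: 'X_j) \mPo B = \sum_(j < m) e j *: tnth B j.
  rewrite raddf_sum; apply: eq_bigr => j _ /=.
  by rewrite comp_mpolyZ comp_mpolyXU -tnth_nth.
have CK : cancel (comp_mpoly C) (comp_mpoly B).
  move=> p; rewrite comp_mpolyA -[RHS]comp_mpoly_id; congr (p \mPo _).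
  apply: eq_from_tnth => i; rewrite !tnth_mktuple lincomp.
  by have [<- _] := hc i.
exists C; split=> // p.
rewrite comp_mpolyA -[RHS]comp_mpoly_id; congr (p \mPo _).
apply: eq_from_tnth => i; rewrite !tnth_mktuple.
have hD := comp_mpoly_homog (hB i) hC.
have [e [_ ue]] := uB _ (hB i).
(* Both sides are coordinates of [tnth B i] in the basis [B], hence equal. *)
have eqe : [ffun j => (tnth B i \mPo C)@_U_(j)] = [ffun j => (j == i)%:R].
  transitivity e; [symmetry|]; apply: ue; last first.
    rewrite (bigD1 i) //= ffunE eqxx scale1r big1 ?addr0 // => j ji.
    by rewrite ffunE (negbTE ji) scale0r.
  rewrite -{1}(CK (tnth B i)) {1}(homog1E hD) lincomp.
  by apply: eq_bigr => j _; rewrite ffunE.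
rewrite (homog1E hD).
rewrite (bigD1 i) //= big1 => [|j ji].
  by have /ffunP/(_ i) := eqe; rewrite !ffunE eqxx => ->; rewrite scale1r addr0.
by have /ffunP/(_ j) := eqe; rewrite !ffunE (negbTE ji) => ->; rewrite scale0r.
Qed.

(** * Primality of linear forms and the number of prime divisors *)

Lemma mpolyX0_dvd (K : fieldType) (n : nat) (p : {mpoly K[n.+1]}) :
  {in msupp p, forall a : 'X_{1..n.+1}, (0 < a ord0)%N} ->
  exists q, p = q * 'X_ord0.
Proof.
move=> hp; exists (\sum_(a <- msupp p) p@_a *: 'X_[a - U_(ord0)]).
rewrite {1}(mpolyE p) mulr_suml !big_seq; apply: eq_bigr => a /hp a0.
rewrite -scalerAl -mpolyXD submK //; apply/mnm_lepP => i.
by rewrite mnm1E; case: eqVneq => [<-|].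
Qed.

(** Reduction modulo the variable of index 0, kept inside the same ring. *)
Definition kill0 (K : fieldType) (n : nat) : n.+1.-tuple {mpoly K[n.+1]} :=
  [tuple if i == ord0 then 0 else 'X_i | i < n.+1].

Lemma mcoeff_kill0 (K : fieldType) (n : nat) (p : {mpoly K[n.+1]})
    (m : 'X_{1..n.+1}) :
  m ord0 = 0%N -> (p \mPo kill0 K n)@_m = p@_m.
Proof.
move=> m0; rewrite comp_mpolyEX [in RHS](mpolyE p) !raddf_sum /=.
apply: eq_bigr => a _; rewrite !mcoeffZ; congr (_ * _).
rewrite comp_mpolyX; have [a0|a0] := eqVneq (a ord0) 0%N.
  congr (_@_m); rewrite mpolyXE_id; apply: eq_bigr => i _.
  by rewrite tnth_mktuple; case: eqVneq => [->|//]; rewrite a0 !expr0.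
rewrite (bigD1 ord0) //= tnth_mktuple eqxx expr0n (negbTE a0) mul0r mcoeff0.
by rewrite mcoeffX; case: eqVneq => // am; rewrite am m0 in a0.
Qed.

(** After the inverse change of coordinates [l] becomes ['X_ord0], whose multiples include the
    kernel of [kill0]; a product that vanishes under this map into a domain has a vanishing
    factor. *)
Lemma linear_basis_prime (K : fieldType) (n : nat) (l : {mpoly K[n.+1]})
    (z : n.-tuple {mpoly K[n.+1]}) (p q : {mpoly K[n.+1]}) :
  linear_basis [tuple of l :: z] ->
  (exists s, p * q = s * l) ->
  (exists s, p = s * l) \/ (exists s, q = s * l).
Proof.
move=> /linear_basis_inverse [C [_ BK CK]].
have X0 : ('X_ord0 : {mpoly K[n.+1]}) \mPo [tuple of l :: z] = l.
  by rewrite comp_mpolyXU.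
have dvd u : (u \mPo C) \mPo kill0 K n = 0 -> exists s, u = s * l.
  move=> u0; have [|s /(congr1 (comp_mpoly [tuple of l :: z]))] :=
    @mpolyX0_dvd _ _ (u \mPo C).
    move=> a; rewrite mcoeff_msupp lt0n; apply: contraNneq => a0.
    by rewrite -mcoeff_kill0 // u0 mcoeff0.
  by rewrite CK rmorphM /= X0 => ->; exists (s \mPo [tuple of l :: z]).
case=> s /(congr1 (fun u => (u \mPo C) \mPo kill0 K n)).
rewrite !rmorphM /= -[in X in _ = _ * X]X0 BK comp_mpolyXU -tnth_nth.
rewrite tnth_mktuple /=.
move/eqP; rewrite mulr0 mulf_eq0 => /orP[] /eqP /dvd; [by left|by right].
Qed.

(** Split off [l ord0]: each other [l i] is prime and does not divide [l ord0], so it divides the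
    cofactor, whose degree is smaller. The bound is strict because [msize] is the degree plus
    one. *)
Lemma pairwise_prime_divisors (K : fieldType) (m N : nat) (F : {mpoly K[m]})
    (l : 'I_N -> {mpoly K[m]}) :
  F != 0 -> (forall i, (1 < msize (l i))%N) ->
  (forall i p q, (exists s, p * q = s * l i) ->
     (exists s, p = s * l i) \/ (exists s, q = s * l i)) ->
  (forall i j, (exists s, l i = s * l j) -> i = j) ->
  (forall i, exists s, F = s * l i) ->
  (N < msize F)%N.
Proof.
elim: N F l => [|N IH] F l F0 sl prl dl dF.
  by rewrite lt0n msize_poly_eq0.
have [G FG] := dF ord0.
have G0 : G != 0 by apply: contraNneq F0 => G0; rewrite FG G0 mul0r.
have l0 : l ord0 != 0 by rewrite -msize_poly_eq0 -lt0n ltnW.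
have NG : (N < msize G)%N.
  apply: (IH G (fun i => l (lift ord0 i))) => // [i p q|i j /dl|i].
  - exact: prl.
  - exact: lift_inj.
  have [s] := dF (lift ord0 i); rewrite FG => Gs.
  have [//|/dl /eqP] := prl (lift ord0 i) G (l ord0) (ex_intro _ s Gs).
  by rewrite (negbTE (neq_lift _ _)).
rewrite FG msizeM //; have := sl ord0; move: NG.
by move: (msize G) (msize (l ord0)) => a b; lia.
Qed.

(** * Contraction and a lower bound for the length *)

Lemma mcoeff_contraction (K : fieldType) (n : nat) (g f : {mpoly K[n]})
    (m : 'X_{1..n}) :
  (contraction g f)@_m =
    \sum_(a <- msupp f | (m <= a)%MM) g@_(a - m) * f@_a.
Proof.
rewrite /contraction raddf_sum /=.
under eq_bigr => b _ do rewrite raddf_sum big_mkcond /=.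
rewrite exchange_big [RHS]big_mkcond /=; apply: eq_bigr => a _.
have shift b :
    (b <= a)%MM && ((a - b)%MM == m) = (m <= a)%MM && (b == (a - m)%MM).
  apply/andP/andP => -[/mnm_lepP ba /eqP e].
    rewrite -e lem_subr; split=> //.
    by apply/eqP/mnmP => i; rewrite !mnmBE subKn.
  rewrite e lem_subr; split=> //.
  by apply/eqP/mnmP => i; rewrite !mnmBE subKn.
transitivity (\sum_(b <- msupp g)
    ((m <= a)%MM && (b == (a - m)%MM))%:R * (g@_b * f@_a)).
  apply: eq_bigr => b _; rewrite -shift; case: (b <= a)%MM; rewrite ?mul0r //=.
  by rewrite mcoeffZ mcoeffX mulrC.
case: (m <= a)%MM => /=; last by rewrite big1 // => b _; rewrite mul0r.
rewrite [in RHS](mpolyE g) raddf_sum mulr_suml /=; apply: eq_bigr => b _.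
by rewrite mcoeffZ mcoeffX mulrCA mulrA.
Qed.

Lemma contraction_suml (K : fieldType) (n : nat) (I : finType) (v : I -> K)
    (p : I -> {mpoly K[n]}) (f : {mpoly K[n]}) :
  contraction (\sum_i v i *: p i) f = \sum_i v i *: contraction (p i) f.
Proof.
apply/mpolyP => m; rewrite mcoeff_contraction raddf_sum /=.
under [RHS]eq_bigr => i _ do rewrite mcoeffZ mcoeff_contraction mulr_sumr.
rewrite exchange_big /=; apply: eq_bigr => a _.
by rewrite raddf_sum mulr_suml; apply: eq_bigr => i _ /=; rewrite mcoeffZ mulrA.
Qed.

(** The coordinates of the [p i] modulo [Ann f] form a matrix with more rows than columns; a nonzero
    vector of its left kernel gives the relation. *)
Lemma quotient_dim_dependent (K : fieldType) (n r s : nat) (f : {mpoly K[n]})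
    (p : 'I_s -> {mpoly K[n]}) :
  quotient_dim (Ann f) r -> (r < s)%N ->
  exists2 v : 'rV[K]_s,
    v != 0 & contraction (\sum_i v ord0 i *: p i) f = 0.
Proof.
case=> b hb rs.
have [c hc] := fin_all_exists (fun i => hb (p i)).
pose M := \matrix_(i < s, k < r) c i k.
have /rowV0Pn [v /sub_kermxP vM v0] : kermx M != 0.
  rewrite kermx_eq0 /row_free; apply: contraTneq rs => Ms.
  by rewrite -leqNgt -Ms rank_leq_col.
exists v => //.
have -> : \sum_i v ord0 i *: p i =
          \sum_i v ord0 i *: (p i - \sum_(k < r) c i k *: b k).
  under [RHS]eq_bigr => i _ do rewrite scalerBr scaler_sumr.
  rewrite sumrB exchange_big /= [X in _ - X]big1 ?subr0 // => k _.
  under eq_bigr => i _ do rewrite scalerA.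
  rewrite -scaler_suml.
  have /matrixP/(_ ord0 k) := vM; rewrite !mxE => vk.
  rewrite (_ : \sum_i v ord0 i * c i k = 0) ?scale0r // -[RHS]vk.
  by apply: eq_bigr => i _; rewrite mxE.
rewrite contraction_suml big1 // => i _.
by have [/eqP -> _] := hc i; rewrite scaler0.
Qed.

Lemma divisor_of_mdeg (n i : nat) (a : 'X_{1..n}) :
  (i <= mdeg a)%N -> exists2 b : 'X_{1..n}, (b <= a)%MM & mdeg b = i.
Proof.
elim: i => [_|i IH ia]; first exists 0%MM; rewrite ?mdeg0 //.
  by apply/mnm_lepP => j; rewrite mnm0E.
have [b /mnm_lepP ba bi] := IH (ltnW ia).
have [j bj|all_ge] := pickP (fun j => b j < a j)%N.
  exists (b + U_(j))%MM; last by rewrite mdegD mdeg1 bi addn1.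
  apply/mnm_lepP => k; rewrite mnmDE mnm1E.
  by case: eqVneq => [<-|_]; rewrite ?addn1 ?addn0.
move: ia; rewrite -bi ltnNge !mdegE leq_sum // => j _.
by rewrite leqNgt all_ge.
Qed.

(** Otherwise divisors [c i] of [a], one in each degree up to [mdeg a], are dependent modulo
    [Ann f]. The lowest term [c i] of the relation [g] contradicts this: in the contraction of [f]
    by [g], the coefficient at [a - c i] comes from [a] alone. *)
Lemma mdeg_lt_quotient_dim (K : fieldType) (n r : nat) (f : {mpoly K[n]})
    (a : 'X_{1..n}) :
  quotient_dim (Ann f) r -> a \in msupp f ->
  {in msupp f, forall m, (mdeg m <= mdeg a)%N} -> (mdeg a < r)%N.
Proof.
move=> hr af amax; rewrite ltnNge; apply/negP => ra.
have [c ca ci] := fin_all_exists2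
  (fun i : 'I_(mdeg a).+1 => divisor_of_mdeg (ltn_ord i)).
have [v v0 vf] := quotient_dim_dependent (fun i => 'X_[c i]) hr ra.
have [i1 vi1] := matrix.rV0Pn v v0.
have [i vi imin] := @arg_minnP _ i1 (fun i => v ord0 i != 0) val vi1.
set g := \sum_i _ in vf.
have /mpolyP/(_ (a - c i)%MM) := vf.
rewrite mcoeff0 mcoeff_contraction big_mkcond (bigD1_seq a) //= lem_subr.
have coef m : g@_m = \sum_j v ord0 j * (c j == m)%:R.
  by rewrite raddf_sum; apply: eq_bigr => j _; rewrite /= mcoeffZ mcoeffX.
have low m : (mdeg m <= i)%N -> m != c i -> g@_m = 0.
  move=> mi mci; rewrite coef big1 // => j _.
  have [vj|/imin ij] := eqVneq (v ord0 j) 0; first by rewrite vj mul0r.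
  case: eqVneq => [cj|]; last by rewrite mulr0.
  have ji : j = i by apply/ord_inj/eqP; rewrite eqn_leq -{1}(ci j) cj mi.
  by rewrite -cj ji eqxx in mci.
(* A monomial [m] of [f] other than [a] would need the term [m - (a - c i)] of [g]. Since [mdeg a]
   is maximal, that term has degree at most [i], and it is not [c i], so its coefficient is zero. *)
rewrite big_seq_cond big1 ?addr0 => [|m /andP[mf ma]]; last first.
  case: ifP => // am.
  have da : (mdeg (a - c i) + i = mdeg a)%N.
    by rewrite -[X in (_ + X)%N](ci i) -mdegD submK.
  have dm : (mdeg (m - (a - c i)) + mdeg (a - c i) = mdeg m)%N.
    by rewrite -mdegD submK.
  rewrite low ?mul0r //.
    by rewrite -(leq_add2r (mdeg (a - c i))) dm addnC da amax.
  apply: contraNneq ma => e.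
  by rewrite -(submK am) e addmC submK.
have cia : (a - (a - c i))%MM = c i.
  by apply/mnmP => k; rewrite !mnmBE subKn //; apply/mnm_lepP.
rewrite cia coef (bigD1 i) //= eqxx mulr1 big1 ?addr0 => [/eqP|j ji].
  by rewrite mulf_eq0 (negbTE vi) mcoeff_eq0 af.
case: eqVneq => [e|]; last by rewrite mulr0.
by case/eqP: ji; apply: ord_inj; rewrite -(ci j) e ci.
Qed.

(** * Degree of the dual generator *)

Definition mtail (n : nat) (a : 'X_{1..n.+1}) : 'X_{1..n} :=
  [multinom a (lift ord0 j) | j < n].

Lemma mdeg_mtail (n : nat) (a : 'X_{1..n.+1}) :
  mdeg a = (a ord0 + mdeg (mtail a))%N.
Proof.
by rewrite !mdegE big_ord_recl; under [in RHS]eq_bigr => j _ do rewrite mnmE.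
Qed.

(** The degree recovers the exponent at index 0, so dehomogenizing a form never merges two of its
    terms. *)
Lemma mtail_inj (n : nat) (a b : 'X_{1..n.+1}) :
  mdeg a = mdeg b -> mtail a = mtail b -> a = b.
Proof.
move=> dab tab; apply/mnmP => i; case: (unliftP ord0 i) => [j ->|->].
  by have /mnmP/(_ j) := tab; rewrite !mnmE.
by move: dab; rewrite !mdeg_mtail tab => /addIn.
Qed.

Lemma mcoeff_dehomogenize_dp (K : fieldType) (n : nat) (p : {mpoly K[n.+1]})
    (m : 'X_{1..n}) :
  (dehomogenize (divided_power p))@_m =
    \sum_(a <- msupp p | mtail a == m) (\prod_(i < n.+1) (a i)`!)%:R * p@_a.
Proof.
rewrite /dehomogenize /divided_power (raddf_sum (comp_mpoly _)) raddf_sum.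
rewrite [RHS]big_mkcond /=.
apply: eq_bigr => a _; rewrite comp_mpolyZ mcoeffZ comp_mpolyX big_ord_recl.
rewrite (tnth_nth 0) /= expr1n mul1r.
rewrite (eq_bigr (fun j : 'I_n => 'X_j ^+ mtail a j)) => [|j _]; last first.
  rewrite (tnth_nth 0) /= add0n mnmE (nth_map j) ?size_enum_ord //.
  by rewrite nth_ord_enum.
by rewrite -mpolyXE_id mcoeffX; case: eqP; rewrite ?mulr1 ?mulr0.
Qed.

(** A prime dividing a factor of the factorial is at most [d], so it is not the characteristic. *)
Lemma natf_factorial_neq0 (K : fieldType) (d k : nat) :
  (forall q : nat, q \in [pchar K] -> (d < q)%N) -> (k <= d)%N ->
  (k`!)%:R != 0 :> K.
Proof.
move=> charK; elim: k => [|k IH] kd; first by rewrite oner_eq0.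
rewrite factS natrM mulf_neq0 ?IH ?(ltnW kd) // natf_neq0_pchar.
apply/pnatP => // q _ /dvdn_leq qk; apply/negP => /charK.
by rewrite ltnNge (leq_trans (qk _) kd).
Qed.

(** If [l] does not divide [F], the expression of [F] in the basis has a monomial without [l].
    Setting [l] to 1 keeps its degree [d], and the factorials multiplying its coefficient are
    nonzero. *)
Lemma mdeg_dual_generator (K : fieldType) (n d : nat) (F l : {mpoly K[n.+1]})
    (z : n.-tuple {mpoly K[n.+1]}) (f : {mpoly K[n]}) :
  (forall q : nat, q \in [pchar K] -> (d < q)%N) -> F \is d.-homog ->
  dual_generator F l z f -> ~ (exists s, F = s * l) ->
  {in msupp f, forall m, (mdeg m <= d)%N} /\
  (exists2 a, a \in msupp f & mdeg a = d).
Proof.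
move=> charK hF [hB [p Fp ->]] Nl.
have hp : p \is d.-homog.
  have [C [hC BK _]] := linear_basis_inverse hB.
  by rewrite -[p]BK -Fp comp_mpoly_homog.
split=> [m|].
  rewrite mcoeff_msupp; apply: contraNT; rewrite -ltnNge => dm.
  rewrite mcoeff_dehomogenize_dp big_seq_cond big1 // => a /andP[ap /eqP am].
  have da : mdeg a = d := dhomog_mf hp ap.
  by move: dm; rewrite -da mdeg_mtail am ltnNge leq_addl.
have [a ap a0] : exists2 a, a \in msupp p & a ord0 = 0%N.
  have [/hasP [a ap /eqP a0]|/hasPn pos] :=
    boolP (has (fun a : 'X_{1..n.+1} => a ord0 == 0%N) (msupp p)).
    by exists a.
  have [|s ps] := @mpolyX0_dvd _ _ p; first by move=> a /pos; rewrite lt0n.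
  case: Nl; exists (s \mPo [tuple of l :: z]).
  by rewrite Fp ps rmorphM /= comp_mpolyXU.
have da : mdeg a = d := dhomog_mf hp ap.
exists (mtail a); last by rewrite -da mdeg_mtail a0.
(* Among the monomials of [p], all of degree [d], only [a] has tail [mtail a]. *)
rewrite mcoeff_msupp mcoeff_dehomogenize_dp big_mkcond (bigD1_seq a) //= eqxx.
rewrite [X in _ + X]big_seq_cond [X in _ + X]big1 => [|b /andP[bp ba]];
  last first.
  case: (mtail b =P mtail a) => // /mtail_inj ab; case/eqP: ba; apply: ab.
  by rewrite da; exact: (dhomog_mf hp bp).
rewrite addr0 mulf_neq0 -?mcoeff_msupp // natr_prod.
apply/prodf_neq0 => i _.
apply: natf_factorial_neq0 charK _.
by rewrite -da mdegE (bigD1 i) //= leq_addr.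
Qed.

(** * Minimal supports as divisors, and the count *)

Lemma small_size_dvd (K : fieldType) (n d r : nat) (F l : {mpoly K[n.+1]}) :
  (forall q : nat, q \in [pchar K] -> (d < q)%N) -> F \is d.-homog ->
  local_gad_size d F l r -> (r <= d)%N -> exists s, F = s * l.
Proof.
move=> charK hF [[k [omega [_ kd _ Nl Fo]]] [z [f [hf hr]]]] rd.
(* For [k < d] the decomposition shows a factor [l]. For [k = d], [omega] is [F] itself, prime to
   [l], and the size would exceed [d]. *)
have [dk|kd'] := ltnP k d.
  exists (omega * l ^+ (d - k).-1).
  by rewrite Fo -mulrA -exprSr prednK ?subn_gt0.
have kd_eq : k = d by apply/eqP; rewrite eqn_leq kd.
move: Fo; rewrite kd_eq subnn expr0 mulr1 => Fo.
rewrite -Fo in Nl.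
have [fd [a af da]] := mdeg_dual_generator charK hF hf Nl.
have := mdeg_lt_quotient_dim hr af; rewrite da => /(_ fd).
by rewrite ltnNge rd.
Qed.

Unset Implicit Arguments.

Theorem proposition3p5 (n d : nat) (K : fieldType) (n_ge1 : (1 <= n)%N)
    (char_gt_d : forall p : nat, p \in [pchar K] -> (d < p)%N)
    (F : {mpoly K[n.+1]}) (F_homog : F \is d.-homog) (F_neq0 : F != 0)
    (r : nat) (rank_F : local_gad_rank d F r) (r_le_d : (r <= d)%N)
    (N : nat) (l : 'I_N -> {mpoly K[n.+1]})
    (l_min : forall i : 'I_N, minimal_support d F (l i))
    (l_distinct : forall i j : 'I_N, proportional (l i) (l j) -> i = j) :
  (N <= d ^ n)%N.
Proof.
(* The rank in [minimal_support] equals [r], each being minimal. *)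
have size_l i : local_gad_size d F (l i) r.
  have [r' [[l' hl'] min_r'] hr'] := l_min i.
  suff -> : r = r' by [].
  have [[l'' hl''] min_r] := rank_F.
  by apply/eqP; rewrite eqn_leq (min_r _ _ hr') (min_r' _ _ hl'').
have hl i : l i \is 1.-homog /\ l i != 0.
  by have [[k [omega [[h1 h0] _ _ _ _]]] _] := size_l i.
have sl i : msize (l i) = 2%N.
  have [h1 h0] := hl i; have := dhomog_mf h1 (mlead_supp h0).
  by move=> /= e; rewrite -mlead_deg // e.
have NF : (N < msize F)%N.
  apply: (@pairwise_prime_divisors _ _ _ F l) => // [i|i p q|i j [s ls]|i].
  - by rewrite sl.
  - have [_ [z [f [[hB _] _]]]] := size_l i; exact: linear_basis_prime hB.
  - symmetry; apply: l_distinct.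
    (* Both forms have degree 1, so the cofactor [s] is a nonzero constant and the forms are
       proportional. *)
    have s0 : s != 0.
      by apply: contraNneq (hl i).2 => s0; rewrite ls s0 mul0r.
    have := msizeM s0 (hl j).2; rewrite -ls !sl addn2 => -[s1].
    have /msize_poly1P [c c0 sc] : msize s == 1%N by rewrite -s1.
    by exists c => //; rewrite ls sc mul_mpolyC.
  - exact: small_size_dvd (size_l i) r_le_d.
have Nd : (N <= d)%N.
  have dF : mdeg (mlead F) = d := dhomog_mf F_homog (mlead_supp F_neq0).
  by rewrite -ltnS -[X in (_ < X.+1)%N]dF mlead_deg.
apply: leq_trans Nd _.
(* Monotonicity of powers in the exponent needs a positive base, so [d = 0] is split off; there the
   left side is 0. *)
case: d {char_gt_d F_homog rank_F r_le_d l_min size_l} => // d.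
by rewrite -{1}[d.+1]expn1 leq_pexp2l.
Qed.
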